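(* Let $M$ be a smooth manifold and let $(T^*[1]M,TM,S,\diamond,H)$ and $(T^*[1]M,TM,S,\diamond,H')$ be two skeletal exact CLWX 2-algebroids over $M$, given by closed 4-forms $H,H'\in\Omega^4(M)$. They are isomorphic (as CLWX 2-algebroids) if and only if $H$ and $H'$ are in the same cohomology class.
   Context: A Leibniz 2-algebra consists of a linear map $\mathrm d:V_{-1}\to V_0$, bilinear maps $l_2:V_{-i}\times V_{-j}\to V_{-i-j}$ ($0\le i+j\le1$) and a trilinear $l_3:V_0^3\to V_{-1}$ such that for $w,x,y,z\in V_0$, $m,n\in V_{-1}$: (a) $\mathrm dl_2(x,m)=l_2(x,\mathrm dm)$; (b) $\mathrm dl_2(m,x)=l_2(\mathrm dm,x)$; (c) $l_2(\mathrm dm,n)=l_2(m,\mathrm dn)$; (d) $\mathrm dl_3(x,y,z)=l_2(x,l_2(y,z))-l_2(l_2(x,y),z)-l_2(y,l_2(x,z))$; (e1) $l_3(x,y,\mathrm dm)=l_2(x,l_2(y,m))-l_2(l_2(x,y),m)-l_2(y,l_2(x,m))$; (e2) $l_3(x,\mathrm dm,y)=l_2(x,l_2(m,y))-l_2(l_2(x,m),y)-l_2(m,l_2(x,y))$; (e3) $l_3(\mathrm dm,x,y)=l_2(m,l_2(x,y))-l_2(l_2(m,x),y)-l_2(x,l_2(m,y))$; (f) $l_2(w,l_3(x,y,z))-l_2(x,l_3(w,y,z))+l_2(y,l_3(w,x,z))+l_2(l_3(w,x,y),z)-l_3(l_2(w,x),y,z)-l_3(x,l_2(w,y),z)-l_3(x,y,l_2(w,z))+l_3(w,l_2(x,y),z)+l_3(w,y,l_2(x,z))-l_3(w,x,l_2(y,z))=0$.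 A morphism of Leibniz 2-algebras consists of linear maps $f_0:V_0\to V_0'$, $f_1:V_{-1}\to V_{-1}'$ with $f_0\mathrm d=\mathrm d'f_1$ and a bilinear $f_2:V_0\times V_0\to V_{-1}'$ with $f_0l_2(x,y)-l_2'(f_0x,f_0y)=\mathrm d'f_2(x,y)$, $f_1l_2(x,m)-l_2'(f_0x,f_1m)=f_2(x,\mathrm dm)$, $f_1l_2(m,x)-l_2'(f_1m,f_0x)=f_2(\mathrm dm,x)$, and $-f_1l_3(x,y,z)+l_2'(f_0x,f_2(y,z))-l_2'(f_0y,f_2(x,z))-l_2'(f_2(x,y),f_0z)-f_2(l_2(x,y),z)+f_2(x,l_2(y,z))-f_2(y,l_2(x,z))+l_3'(f_0x,f_0y,f_0z)=0$. It is an isomorphism if $f_0,f_1$ are invertible. A CLWX 2-algebroid $(E_{-1},E_0,\partial,\rho,S,\diamond,\Omega)$ over $M$ is a graded vector bundle $E_{-1}\oplus E_0$ with a nondegenerate symmetric bilinear form $S$, a bilinear operation $\diamond:\Gamma(E_{-i})\times\Gamma(E_{-j})\to\Gamma(E_{-(i+j)})$, $0\le i+j\le1$, skew-symmetric on $\Gamma(E_0)\times\Gamma(E_0)$, an $E_{-1}$-valued 3-form $\Omega$ on $E_0$, and bundle maps $\partial:E_{-1}\to E_0$, $\rho:E_0\to TM$, such that $E_{-1},E_0$ are isotropic and: (i) $(\Gamma(E_{-1}),\Gamma(E_0),\partial,\diamond,\Omega)$ is a Leibniz 2-algebra; (ii) $e\diamond e=\frac12\mathcal DS(e,e)$; (iii)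 $S(\partial e^1_1,e^1_2)=S(e^1_1,\partial e^1_2)$ for $e^1_i\in\Gamma(E_{-1})$; (iv) $\rho(e_1)S(e_2,e_3)=S(e_1\diamond e_2,e_3)+S(e_2,e_1\diamond e_3)$ ($\rho$ understood to vanish on $E_{-1}$); (v) $S(\Omega(e^0_1,e^0_2,e^0_3),e^0_4)=-S(e^0_3,\Omega(e^0_1,e^0_2,e^0_4))$; where $\mathcal D:C^\infty(M)\to\Gamma(E_{-1})$, $S(\mathcal Df,e^0)=\rho(e^0)(f)$. It is exact if $0\to T^*M\xrightarrow{\rho^*}E_{-1}\xrightarrow{\partial}E_0\xrightarrow{\rho}TM\to0$ is exact, where $S(\rho^*(\alpha),e^0)=\langle\alpha,\rho(e^0)\rangle$; skeletal if $\partial=0$. For a closed 4-form $H$, $(T^*[1]M,TM,S,\diamond,H)$ denotes the skeletal exact CLWX 2-algebroid with $E_{-1}=T^*M$, $E_0=TM$, $\partial=0$, $\rho=\mathrm{id}$, $S(X+\alpha,Y+\beta)=\langle\alpha,Y\rangle+\langle\beta,X\rangle$, $X\diamond Y=[X,Y]$, $X\diamond\alpha=L_X\alpha$, $\alpha\diamond X=-\iota_Xd\alpha$, and $\Omega$ determined by $S(\Omega(X,Y,Z),W)=H(X,Y,Z,W)$. An isomorphism of CLWX 2-algebroids from $(E_{-1},E_0,\partial,\rho,S,\diamond,\Omega)$ to $(E'_{-1},E'_0,\partial',\rho',S',\diamond',\Omega')$ consists of bundle isomorphisms $\Phi_0:E_0\to E_0'$, $\Phi_1:E_{-1}\to E_{-1}'$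 and a bundle map $\Phi_2:\wedge^2E_0\to E_{-1}'$ such that $\rho'\circ\Phi_0=\rho$, $S'(\Phi_0(e^0),\Phi_1(e^1))=S(e^0,e^1)$ for $e^0\in\Gamma(E_0)$, $e^1\in\Gamma(E_{-1})$, and $(\Phi_0,\Phi_1,\Phi_2)$ is an isomorphism of the associated Leibniz 2-algebras of sections. *)

(* Defs.v *)
From HB Require Import structures.
From mathcomp Require Import all_boot all_order all_algebra.
From mathcomp Require Import all_classical all_reals all_analysis.
From mathcomp Require Import ring.
Set Implicit Arguments.
Unset Strict Implicit.
Unset Printing Implicit Defensive.
Import Order.TTheory GRing.Theory Num.Theory.
Import numFieldNormedType.Exports.
Local Open Scope classical_set_scope.
Local Open Scope ring_scope.

Section SmoothEuclidean.
Context {R : realType} {n : nat}.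
Implicit Types (U : set 'rV[R]_n) (f g : 'rV[R]_n -> R).

(* All iterated partial derivatives of order <= k exist and are continuous at
   every point of the open set U. The values of f outside U are irrelevant. *)
Fixpoint Ck (k : nat) U f : Prop :=
  (forall x, U x -> {for x, continuous f}) /\
  if k is k'.+1 then
    forall i : 'I_n,
      (forall x, U x -> derivable f x (delta_mx 0 i)) /\
      Ck k' U ('D_(delta_mx 0 i) f)
  else True.

Definition smooth_on U f := forall k, Ck k U f.

Lemma Ck_cont k U f : Ck k U f -> forall x, U x -> {for x, continuous f}.
Proof. by case: k => [|k] []. Qed.

Lemma CkS k U f : Ck k.+1 U f -> Ck k U f.
Proof.
elim: k f => [|k IH] f [cf df]; first by split.
by split => // i; have [dfi Cfi] := df i; split => //; exact: IH.
Qed.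

Lemma eq_on_open U f g x : open U -> U x -> (forall y, U y -> f y = g y) ->
  {near x, f =1 g}.
Proof.
by move=> oU Ux fg; apply: filterS (open_nbhs_nbhs (conj oU Ux)) => y /fg.
Qed.

Lemma continuous_eq_on U f g x : open U -> U x -> (forall y, U y -> f y = g y) ->
  {for x, continuous f} -> {for x, continuous g}.
Proof.
move=> oU Ux fg cf; have {}cf : f y @[y --> x] --> g x by rewrite -fg.
apply: cvg_trans cf; apply: (@near_eq_cvg _ _ (nbhs x) (nbhs_filter x)).
exact: eq_on_open fg.
Qed.

Lemma Ck_eq k U f g : open U -> (forall x, U x -> f x = g x) ->
  Ck k U f -> Ck k U g.
Proof.
move=> oU; elim: k f g => [|k IH] f g fg [cf df].
  by split=> // x Ux; apply: continuous_eq_on fg (cf x Ux).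
split=> [x Ux|i]; first exact: continuous_eq_on fg (cf x Ux).
have [dfi Cfi] := df i; split => [x Ux|].
  by apply: near_eq_derivable (dfi x Ux); exact: eq_on_open fg.
by apply: IH Cfi => x Ux; apply: near_eq_derive; exact: eq_on_open fg.
Qed.

Lemma Ck_cst k U (c : R) : Ck k U (cst c).
Proof.
elim: k c => [|k IH] c; first by split=> // x _; exact: cst_continuous.
split=> [x _|i]; first exact: cst_continuous.
split=> [x _|]; first exact: derivable_cst.
by rewrite (_ : 'D__ _ = cst 0) //; apply/funext => x; rewrite derive_cst.
Qed.

Lemma CkB k U f g : open U -> Ck k U f -> Ck k U g -> Ck k U (f - g).
Proof.
move=> oU; elim: k f g => [|k IH] f g [cf df] [cg dg].
  by split => // x Ux; apply: continuousB; [exact: cf|exact: cg].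
split => [x Ux|i]; first by apply: continuousB; [exact: cf|exact: cg].
have [dfi Cfi] := df i; have [dgi Cgi] := dg i.
split => [x Ux|]; first by apply: derivableB; [exact: dfi|exact: dgi].
apply: Ck_eq (IH _ _ Cfi Cgi) => // x Ux.
by rewrite deriveB; [|exact: dfi|exact: dgi].
Qed.

Lemma CkD k U f g : open U -> Ck k U f -> Ck k U g -> Ck k U (f + g).
Proof.
move=> oU Cf Cg; rewrite -[g]opprK -[- g]sub0r.
by do 2![apply: CkB => //]; exact: Ck_cst.
Qed.

Lemma CkM k U f g : open U -> Ck k U f -> Ck k U g -> Ck k U (f * g).
Proof.
move=> oU; elim: k f g => [|k IH] f g Cf Cg.
  by split => // x Ux; apply: continuousM; [exact: Ck_cont Cf _ Ux|exact: Ck_cont Cg _ Ux].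
split => [x Ux|i].
  by apply: continuousM; [exact: Ck_cont Cf _ Ux|exact: Ck_cont Cg _ Ux].
have [dfi Cfi] := Cf.2 i; have [dgi Cgi] := Cg.2 i.
split => [x Ux|]; first by apply: derivableM; [exact: dfi|exact: dgi].
apply: (@Ck_eq k U (f * 'D_(delta_mx 0 i) g + g * 'D_(delta_mx 0 i) f)) => //.
  by move=> x Ux; rewrite deriveM; [|exact: dfi|exact: dgi].
by apply: CkD => //; apply: IH => //; exact: CkS.
Qed.

End SmoothEuclidean.

(* A chart is a homeomorphism from an open subset of the space onto an open
   subset of R^n. Both maps are total; only their values on dom and on the image
   of dom are meaningful. *)
Record chart (T : topologicalType) (R : realType) (n : nat) := Chart {
  dom : set T;
  coord : T -> 'rV[R]_n;
  icoord : 'rV[R]_n -> T;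
  chart_open_dom : open dom;
  chart_open_img : open (coord @` dom);
  chartK : forall p, dom p -> icoord (coord p) = p;
  chart_cont : forall p, dom p -> {for p, continuous coord};
  chart_icont : forall x, (coord @` dom) x -> {for x, continuous icoord} }.

Record manifold (R : realType) (n : nat) := Manifold {
  space :> topologicalType;
  atlas : set (chart space R n);
  manifold_hausdorff : hausdorff_space space;
  manifold_countable : @second_countable space;
  manifold_cover : forall p : space, exists2 c, atlas c & dom c p;
  manifold_compat : forall c c', atlas c -> atlas c' -> forall j : 'I_n,
    smooth_on (coord c @` (dom c `&` dom c')) (fun x => coord c' (icoord c x) 0 j) }.

Definition smooth_fun (R : realType) n (M : manifold R n) (f : M -> R) : Prop :=
  forall c, atlas c -> smooth_on (coord c @` dom c) (f \o icoord c).

Definition smooth_pred (R : realType) n (M : manifold R n) : {pred M -> R} :=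
  fun f => `[< smooth_fun f >].

Record Cinf (R : realType) n (M : manifold R n) := MkCinf {
  Cinf_fun :> M -> R;
  _ : Cinf_fun \in @smooth_pred R n M }.

Section SmoothRing.
Context {R : realType} {n : nat} {M : manifold R n}.

HB.instance Definition _ := [isSub of Cinf M for @Cinf_fun R n M].
HB.instance Definition _ := [Choice of Cinf M by <:].

Lemma smooth_fun_cst (a : R) : smooth_fun (cst a : M -> R).
Proof. by move=> c _ k; exact: Ck_cst. Qed.

Lemma smooth_subring_closed : subring_closed (@smooth_pred R n M).
Proof.
split; first by apply/asboolP; exact: smooth_fun_cst.
- move=> f g /asboolP sf /asboolP sg; apply/asboolP => c ac k.
  exact: (CkB (@chart_open_img _ _ _ c) (sf c ac k) (sg c ac k)).
- move=> f g /asboolP sf /asboolP sg; apply/asboolP => c ac k.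
  exact: (CkM (@chart_open_img _ _ _ c) (sf c ac k) (sg c ac k)).
Qed.

HB.instance Definition _ :=
  GRing.SubChoice_isSubComPzRing.Build (M -> R) (@smooth_pred R n M) (Cinf M)
    smooth_subring_closed.

Definition Ccst (a : R) : Cinf M := MkCinf (introT (asboolP _) (smooth_fun_cst a)).

Lemma CinfP (f g : Cinf M) : (forall p, f p = g p) -> f = g.
Proof. by move=> fg; apply/val_inj/funext. Qed.

Lemma Ccst_is_zmod : zmod_morphism Ccst.
Proof. by move=> a b; exact: CinfP. Qed.

Lemma Ccst_is_monoid : monoid_morphism Ccst.
Proof. by split => [|a b]; exact: CinfP. Qed.

HB.instance Definition _ := GRing.isZmodMorphism.Build R (Cinf M) Ccst Ccst_is_zmod.
HB.instance Definition _ :=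
  GRing.isMonoidMorphism.Build R (Cinf M) Ccst Ccst_is_monoid.

End SmoothRing.

Section VectorFields.
Context {R : realType} {n : nat}.

(* Vector fields on M are the R-linear derivations of the algebra of smooth
   functions. *)
Definition derivation (M : manifold R n) (X : Cinf M -> Cinf M) : Prop :=
  [/\ forall f g, X (f + g) = X f + X g,
      forall a f, X (Ccst a * f) = Ccst a * X f &
      forall f g, X (f * g) = f * X g + g * X f].

Definition derivation_pred (M : manifold R n) : {pred Cinf M -> (Cinf M)^o} :=
  fun X => `[< derivation X >].

Record vfield (M : manifold R n) := MkVfield {
  vfield_val : Cinf M -> (Cinf M)^o;
  _ : vfield_val \in @derivation_pred M }.

Definition vfield_fun (M : manifold R n) (X : vfield M) : Cinf M -> Cinf M :=
  vfield_val X.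
Coercion vfield_fun : vfield >-> Funclass.

Context {M : manifold R n}.
Local Notation C := (Cinf M).

HB.instance Definition _ := [isSub of vfield M for @vfield_val M].
HB.instance Definition _ := [Choice of vfield M by <:].

Lemma derivation_closed : subsemimod_closed (@derivation_pred M).
Proof.
split; first split.
- apply/asboolP; split=> [f g|a f|f g]; rewrite /GRing.zero /=; ring.
- move=> X Y /asboolP[aX zX lX] /asboolP[aY zY lY]; apply/asboolP.
  split=> [f g|a f|f g].
  + change (X (f + g) + Y (f + g) = (X f + Y f) + (X g + Y g) :> C).
    by rewrite aX aY; ring.
  + change (X (Ccst a * f) + Y (Ccst a * f) = Ccst a * (X f + Y f) :> C).
    by rewrite zX zY; ring.
  + change (X (f * g) + Y (f * g) = f * (X g + Y g) + g * (X f + Y f) :> C).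
    by rewrite lX lY; ring.
- move=> a X /asboolP[aX zX lX]; apply/asboolP; split=> [f g|b f|f g].
  + by change (a * X (f + g) = a * X f + a * X g :> C); rewrite aX; ring.
  + by change (a * X (Ccst b * f) = Ccst b * (a * X f) :> C); rewrite zX; ring.
  + change (a * X (f * g) = f * (a * X g) + g * (a * X f) :> C).
    by rewrite lX; ring.
Qed.

HB.instance Definition _ :=
  GRing.SubChoice_isSubLmodule.Build C (C -> C^o) (@derivation_pred M) (vfield M)
    derivation_closed.

Lemma vfieldP (X : vfield M) : derivation X.
Proof. by case: X => X /= /asboolP. Qed.

Lemma vfield_eqP (X Y : vfield M) : (forall f, X f = Y f) -> X = Y.
Proof. by move=> XY; apply/val_inj/funext. Qed.

Lemma bracket_derivation (X Y : vfield M) :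
  derivation (fun f => X (Y f) - Y (X f)).
Proof.
have [aX zX lX] := vfieldP X; have [aY zY lY] := vfieldP Y.
split=> [f g|a f|f g]; rewrite !(aX, aY, zX, zY, lX, lY).
- by ring.
- by ring.
- by ring.
Qed.

Definition bracket (X Y : vfield M) : vfield M :=
  MkVfield (introT (asboolP _) (bracket_derivation X Y)).

End VectorFields.

Section AltForms.
Context {A : comPzRingType}.

Definition multilinear k (V W : lmodType A) (w : ('I_k -> V) -> W) : Prop :=
  forall (i : 'I_k) (x : 'I_k -> V) (a : A) (u v : V),
    w [eta x with i |-> a *: u + v] =
    a *: w [eta x with i |-> u] + w [eta x with i |-> v].

Definition alternating k (V W : lmodType A) (w : ('I_k -> V) -> W) : Prop :=
  forall (x : 'I_k -> V) (i j : 'I_k), i != j -> x i = x j -> w x = 0.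

Definition altform_pred k (V W : lmodType A) : {pred ('I_k -> V) -> W} :=
  fun w => `[< multilinear w /\ alternating w >].

Record altform k (V W : lmodType A) := MkAltform {
  altform_fun :> ('I_k -> V) -> W;
  _ : altform_fun \in @altform_pred k V W }.

Context {k : nat} {V W : lmodType A}.

HB.instance Definition _ := [isSub of altform k V W for @altform_fun k V W].
HB.instance Definition _ := [Choice of altform k V W by <:].

Lemma altform_closed : subsemimod_closed (@altform_pred k V W).
Proof.
split; first split.
- by apply/asboolP; split=> [i x a u v|//]; rewrite scaler0 addr0.
- move=> w w' /asboolP[lw aw] /asboolP[lw' aw']; apply/asboolP.
  split=> [i x a u v|x i j ij xij].
    by change (w [eta x with i |-> a *: u + v] + w' [eta x with i |-> a *: u + v] =
      a *: (w [eta x with i |-> u] + w' [eta x with i |-> u]) +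
      (w [eta x with i |-> v] + w' [eta x with i |-> v]));
      rewrite lw lw' scalerDr addrACA.
  by change (w x + w' x = 0); rewrite (aw x i j) // (aw' x i j) // addr0.
- move=> b w /asboolP[lw aw]; apply/asboolP.
  split=> [i x a u v|x i j ij xij].
    by change (b *: w [eta x with i |-> a *: u + v] =
      a *: (b *: w [eta x with i |-> u]) + b *: w [eta x with i |-> v]);
      rewrite lw scalerDr !scalerA mulrC.
  by change (b *: w x = 0); rewrite (aw x i j) // scaler0.
Qed.

HB.instance Definition _ :=
  GRing.SubChoice_isSubLmodule.Build A (('I_k -> V) -> W) (@altform_pred k V W)
    (altform k V W) altform_closed.

Lemma altformP (w : altform k V W) : multilinear w /\ alternating w.
Proof. by case: w => w /= /asboolP. Qed.

Lemma altform_eqP (w w' : altform k V W) : (forall x, w x = w' x) -> w = w'.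
Proof. by move=> ww'; apply/val_inj/funext. Qed.

End AltForms.

(* The k-tuple of arguments listed in s, where s is meant to have size k. *)
Definition args (V : zmodType) k (s : seq V) : 'I_k -> V := fun i => s`_i.

Section Forms.
Context {R : realType} {n : nat}.
Implicit Types M : manifold R n.

(* Differential k-forms, as alternating maps on vector fields which are
   multilinear over the ring of smooth functions. *)
Definition diff_form M (k : nat) : lmodType (Cinf M) :=
  altform k (vfield M) (Cinf M)^o.

Definition dual_pairing M (alpha : diff_form M 1) (X : vfield M) : Cinf M :=
  alpha (args [:: X]).

(* Koszul's formula for the exterior derivative of w evaluated at X_0, ..., X_k.
   In the second sum the bracket [X_i, X_j] replaces X_i in the list from which
   X_j has been removed; moving it to the front gives the usual sign
   (-1)^(i + j). *)
Definition ext_d M k (w : diff_form M k) (X : 'I_k.+1 -> vfield M) : Cinf M :=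
  \sum_(i < k.+1) (-1) ^+ i * X i (w (X \o lift i)) +
  \sum_(j < k.+1) \sum_(i < k.+1 | (i < j)%N) (-1) ^+ j *
    w (fun m => if lift j m == i then bracket (X i) (X j) else X (lift j m)).

Definition closed_form M k (w : diff_form M k) : Prop := forall X, ext_d w X = 0.

Definition cohomologous M k (w w' : diff_form M k.+1) : Prop :=
  exists K : diff_form M k, forall X, (w - w') X = ext_d K X.

End Forms.

Definition bilin (K : pzRingType) (U V W : lmodType K) (f : U -> V -> W) : Prop :=
  (forall x, linear (f x)) /\ (forall y, linear (f^~ y)).

(* V1 is the degree -1 part V_{-1}; l_ij is the restriction of l_2 to
   V_{-i} x V_{-j}. *)
Record leib2_data (K : pzRingType) (V1 V0 : lmodType K) := Leib2Data {
  l_d : V1 -> V0;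
  l_00 : V0 -> V0 -> V0;
  l_01 : V0 -> V1 -> V1;
  l_10 : V1 -> V0 -> V1;
  l_3 : V0 -> V0 -> V0 -> V1 }.

Record is_leibniz2 (K : pzRingType) (V1 V0 : lmodType K) (L : leib2_data V1 V0)
    : Prop := IsLeibniz2 {
  leib_d_lin : linear (l_d L);
  leib_00_lin : bilin (l_00 L);
  leib_01_lin : bilin (l_01 L);
  leib_10_lin : bilin (l_10 L);
  leib_3_lin : (forall x, bilin (l_3 L x)) /\
               (forall y z, linear (fun x => l_3 L x y z));
  leib_a : forall x m, l_d L (l_01 L x m) = l_00 L x (l_d L m);
  leib_b : forall m x, l_d L (l_10 L m x) = l_00 L (l_d L m) x;
  leib_c : forall m p, l_01 L (l_d L m) p = l_10 L m (l_d L p);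
  leib_d : forall x y z, l_d L (l_3 L x y z) =
    l_00 L x (l_00 L y z) - l_00 L (l_00 L x y) z - l_00 L y (l_00 L x z);
  leib_e1 : forall x y m, l_3 L x y (l_d L m) =
    l_01 L x (l_01 L y m) - l_01 L (l_00 L x y) m - l_01 L y (l_01 L x m);
  leib_e2 : forall x m y, l_3 L x (l_d L m) y =
    l_01 L x (l_10 L m y) - l_10 L (l_01 L x m) y - l_10 L m (l_00 L x y);
  leib_e3 : forall m x y, l_3 L (l_d L m) x y =
    l_10 L m (l_00 L x y) - l_10 L (l_10 L m x) y - l_01 L x (l_10 L m y);
  leib_f : forall w x y z,
    l_01 L w (l_3 L x y z) - l_01 L x (l_3 L w y z) + l_01 L y (l_3 L w x z)
    + l_10 L (l_3 L w x y) z
    - l_3 L (l_00 L w x) y z - l_3 L x (l_00 L w y) z - l_3 L x y (l_00 L w z)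
    + l_3 L w (l_00 L x y) z + l_3 L w y (l_00 L x z) - l_3 L w x (l_00 L y z)
    = 0 }.

Record is_leib2_morphism (K : pzRingType) (V1 V0 V1' V0' : lmodType K)
    (L : leib2_data V1 V0) (L' : leib2_data V1' V0')
    (f0 : V0 -> V0') (f1 : V1 -> V1') (f2 : V0 -> V0 -> V1') : Prop :=
    IsLeib2Morphism {
  lmor_lin0 : linear f0;
  lmor_lin1 : linear f1;
  lmor_lin2 : bilin f2;
  lmor_d : forall m, f0 (l_d L m) = l_d L' (f1 m);
  lmor_00 : forall x y,
    f0 (l_00 L x y) - l_00 L' (f0 x) (f0 y) = l_d L' (f2 x y);
  lmor_01 : forall x m,
    f1 (l_01 L x m) - l_01 L' (f0 x) (f1 m) = f2 x (l_d L m);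
  lmor_10 : forall m x,
    f1 (l_10 L m x) - l_10 L' (f1 m) (f0 x) = f2 (l_d L m) x;
  lmor_3 : forall x y z,
    - f1 (l_3 L x y z) + l_01 L' (f0 x) (f2 y z) - l_01 L' (f0 y) (f2 x z)
    - l_10 L' (f2 x y) (f0 z) - f2 (l_00 L x y) z + f2 x (l_00 L y z)
    - f2 y (l_00 L x z) + l_3 L' (f0 x) (f0 y) (f0 z) = 0 }.

Definition is_leib2_isomorphism (K : pzRingType) (V1 V0 V1' V0' : lmodType K)
    (L : leib2_data V1 V0) (L' : leib2_data V1' V0')
    (f0 : V0 -> V0') (f1 : V1 -> V1') (f2 : V0 -> V0 -> V1') : Prop :=
  [/\ is_leib2_morphism L L' f0 f1 f2, bijective f0 & bijective f1].

(* Restriction of scalars from smooth functions to constants. *)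
Definition real_mod (R : realType) n (M : manifold R n) (E : lmodType (Cinf M)) : Type := E.

Section RealMod.
Context {R : realType} {n : nat} {M : manifold R n} {E : lmodType (Cinf M)}.

HB.instance Definition _ := GRing.Zmodule.on (real_mod E).

Definition real_scale (a : R) (e : real_mod E) : real_mod E := Ccst a *: (e : E).

Lemma real_scaleA a b e : real_scale a (real_scale b e) = real_scale (a * b) e.
Proof. by rewrite /real_scale scalerA -rmorphM. Qed.

Lemma real_scale1 : left_id 1 real_scale.
Proof. by move=> e; rewrite /real_scale rmorph1 scale1r. Qed.

Lemma real_scaleDr : right_distributive real_scale +%R.
Proof. by move=> a e e'; rewrite /real_scale scalerDr. Qed.

Lemma real_scaleDl e : {morph real_scale^~ e : a b / a + b}.
Proof. by move=> a b; rewrite /real_scale rmorphD scalerDl. Qed.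

HB.instance Definition _ := GRing.Zmodule_isLmodule.Build R (real_mod E)
  real_scaleA real_scale1 real_scaleDr real_scaleDl.

End RealMod.

(* The graded vector bundle is given by the modules E1, E0 of sections of E_{-1}
   and E_0 over the ring of smooth functions, so bundle maps over the identity of
   M are maps of sections which are linear over that ring. *)
Record clwx_data (R : realType) n (M : manifold R n) := ClwxData {
  E1 : lmodType (Cinf M);
  E0 : lmodType (Cinf M);
  partial : E1 -> E0;
  anchor : E0 -> vfield M;
  pairing : E1 * E0 -> E1 * E0 -> Cinf M;
  dia_00 : E0 -> E0 -> E0;
  dia_01 : E0 -> E1 -> E1;
  dia_10 : E1 -> E0 -> E1;
  Omega3 : altform 3 E0 E1 }.

Section Clwx.
Context {R : realType} {n : nat} {M : manifold R n}.
Implicit Types D : clwx_data M.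

Definition leib2_of D : leib2_data (real_mod (E1 D)) (real_mod (E0 D)) :=
  Leib2Data (V1 := real_mod (E1 D)) (V0 := real_mod (E0 D))
    (@partial _ _ _ D) (@dia_00 _ _ _ D) (@dia_01 _ _ _ D) (@dia_10 _ _ _ D)
    (fun x y z => Omega3 D (args [:: x; y; z])).

(* The operation on E_{-1} + E_0; it vanishes on E_{-1} x E_{-1}. *)
Definition diamond D (e e' : E1 D * E0 D) : E1 D * E0 D :=
  (dia_10 e.1 e'.2 + dia_01 e.2 e'.1, dia_00 e.2 e'.2).

Definition total_anchor D (e : E1 D * E0 D) : vfield M := anchor e.2.

(* u = D f. By nondegeneracy of the pairing there is exactly one such u. *)
Definition is_calD D (f : Cinf M) (u : E1 D) : Prop :=
  forall x : E0 D, pairing (u, 0) (0, x) = anchor x f.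

(* u = rho^* alpha, where rho^* : T^*M -> E_{-1} *)
Definition is_coanchor D (alpha : diff_form M 1) (u : E1 D) : Prop :=
  forall x : E0 D, pairing (u, 0) (0, x) = dual_pairing alpha (anchor x).

Record is_clwx D : Prop := IsClwx {
  clwx_partial_lin : linear (@partial _ _ _ D);
  clwx_anchor_lin : linear (@anchor _ _ _ D);
  clwx_pairing_lin : forall e : E1 D * E0 D, scalar (pairing e);
  clwx_pairing_sym : forall e e' : E1 D * E0 D, pairing e e' = pairing e' e;
  clwx_isotropic1 : forall u v : E1 D, pairing (u, 0) (v, 0) = 0;
  clwx_isotropic0 : forall x y : E0 D, pairing (0, x) (0, y) = 0;
  (* Fibrewise nondegeneracy: since E_{-1} and E_0 are isotropic, it says that the
     pairing identifies E_{-1} with the dual of E_0; sections of the latter are the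
     linear forms on sections of E_0. *)
  clwx_nondeg : forall e : E1 D * E0 D, (forall e', pairing e e' = 0) -> e = 0;
  clwx_dual : forall phi : E0 D -> Cinf M, scalar phi ->
    exists u : E1 D, forall x, pairing (u, 0) (0, x) = phi x;
  clwx_skew : forall x y : E0 D, dia_00 x y = - dia_00 y x;
  clwx_leibniz : is_leibniz2 (leib2_of D);
  clwx_square : forall (e : E1 D * E0 D) (u : E1 D),
    is_calD (pairing e e) u -> diamond e e = (Ccst (2^-1) *: u, 0);
  clwx_partial_sym : forall u v : E1 D,
    pairing (0, partial u) (v, 0) = pairing (u, 0) (0, partial v);
  clwx_invariance : forall e1 e2 e3 : E1 D * E0 D,
    total_anchor e1 (pairing e2 e3) =
    pairing (diamond e1 e2) e3 + pairing e2 (diamond e1 e3);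
  clwx_Omega_skew : forall x y z t : E0 D,
    pairing (Omega3 D (args [:: x; y; z]), 0) (0, t) =
    - pairing (0, z) (Omega3 D (args [:: x; y; t]), 0) }.

Record clwx := Clwx { clwx_val :> clwx_data M; clwxP : is_clwx clwx_val }.

Definition skeletal D : Prop := forall u : E1 D, partial u = 0.

(* Exactness of 0 -> T^*M -> E_{-1} -> E_0 -> TM -> 0 on sections. As the anchor
   is onto, it amounts to fibrewise exactness. *)
Definition exact_clwx D : Prop :=
  [/\ forall alpha, is_coanchor alpha (0 : E1 D) -> alpha = 0,
      forall u : E1 D, partial u = 0 <-> exists alpha, is_coanchor alpha u,
      forall x : E0 D, anchor x = 0 <-> exists u : E1 D, partial u = x &
      forall X : vfield M, exists x : E0 D, anchor x = X].

Record is_clwx_isomorphism (D D' : clwx) (Phi0 : E0 D -> E0 D')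
    (Phi1 : E1 D -> E1 D') (Phi2 : altform 2 (E0 D) (E1 D')) : Prop :=
    IsClwxIsomorphism {
  ciso_lin0 : linear Phi0;
  ciso_lin1 : linear Phi1;
  ciso_bij0 : bijective Phi0;
  ciso_bij1 : bijective Phi1;
  ciso_anchor : forall x, anchor (Phi0 x) = anchor x;
  ciso_pairing : forall x u, pairing (0, Phi0 x) (Phi1 u, 0) = pairing (0, x) (u, 0);
  ciso_leib2 : is_leib2_isomorphism (leib2_of D) (leib2_of D') Phi0 Phi1
    (fun x y => Phi2 (args [:: x; y])) }.

Definition clwx_isomorphic (D D' : clwx) : Prop :=
  exists Phi0 Phi1 Phi2, @is_clwx_isomorphism D D' Phi0 Phi1 Phi2.

End Clwx.

Arguments clwx {R n} M.

Section AltArgs.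
Context {A : comPzRingType} {k : nat} {V W : lmodType A} (w : altform k V W).

Lemma args_set (s : seq V) (i : 'I_k) u :
  args (set_nth 0 s i u) = [eta args s with i |-> u].
Proof. by apply/funext => j; rewrite /args nth_set_nth. Qed.

Lemma alt_linear (s : seq V) (i : 'I_k) a u v :
  w (args (set_nth 0 s i (a *: u + v))) =
  a *: w (args (set_nth 0 s i u)) + w (args (set_nth 0 s i v)).
Proof. by rewrite !args_set (altformP w).1. Qed.

Lemma alt_eq0 (s : seq V) (i j : 'I_k) : i != j -> s`_i = s`_j -> w (args s) = 0.
Proof. by move=> ij sij; apply: (altformP w).2 ij _. Qed.

Lemma alt_swap (s : seq V) (i j : 'I_k) u v : i != j ->
  w (args (set_nth 0 (set_nth 0 s i u) j v)) =
  - w (args (set_nth 0 (set_nth 0 s i v) j u)).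
Proof.
move=> ij; apply/eqP; rewrite -addr_eq0; apply/eqP.
have swap (s' : seq V) x y : set_nth 0 (set_nth 0 s' i x) j y =
    set_nth 0 (set_nth 0 s' j y) i x.
  by rewrite set_set_nth (negbTE (ij : val i != val j)).
have diag x : w (args (set_nth 0 (set_nth 0 s i x) j x)) = 0.
  by apply: (alt_eq0 ij); rewrite !nth_set_nth /= eqxx (negbTE (ij : val i != val j)) nth_set_nth /= eqxx.
have addr x y z : w (args (set_nth 0 (set_nth 0 s i x) j (y + z))) =
    w (args (set_nth 0 (set_nth 0 s i x) j y)) +
    w (args (set_nth 0 (set_nth 0 s i x) j z)).
  by rewrite -[y in LHS]scale1r alt_linear scale1r.
have addl x y z : w (args (set_nth 0 (set_nth 0 s i (y + z)) j x)) =
    w (args (set_nth 0 (set_nth 0 s i y) j x)) +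
    w (args (set_nth 0 (set_nth 0 s i z) j x)).
  by rewrite !swap -[y in LHS]scale1r alt_linear scale1r.
by have := diag (u + v); rewrite addr !addl !diag add0r addr0 addrC.
Qed.

End AltArgs.

Section MkForms.
Context {R : realType} {n : nat} {M : manifold R n}.
Local Notation C := (Cinf M).
Local Notation V := (vfield M).

Lemma form1_subproof (phi : V -> C) : scalar phi ->
  (fun Y : 'I_1 -> V => phi (Y ord0) : C^o) \in @altform_pred C 1 V C^o.
Proof.
move=> phiL; apply/asboolP; split=> [i x a u v|x i j].
  by rewrite !ord1 /=; exact: phiL.
by rewrite !ord1 eqxx.
Qed.

Definition mk_form1 (phi : V -> C) (phiL : scalar phi) : diff_form M 1 :=
  MkAltform (form1_subproof phiL).

Definition snoc k (X : 'I_k -> V) (Y : V) (i : 'I_k.+1) : V :=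
  oapp X Y (unlift ord_max i).

Lemma snoc_set k (X : 'I_k -> V) Y i u :
  snoc [eta X with i |-> u] Y = [eta snoc X Y with lift ord_max i |-> u].
Proof.
apply/funext => j; rewrite /snoc /=; case: unliftP => [l ->|->] /=.
  by rewrite (inj_eq lift_inj).
by rewrite (negbTE (neq_lift _ _)).
Qed.

Lemma snoc_max k (X : 'I_k -> V) Y u :
  snoc X u = [eta snoc X Y with ord_max |-> u].
Proof.
apply/funext => j; rewrite /snoc /=; case: unliftP => [l ->|->] /=.
  by rewrite eq_sym (negbTE (neq_lift _ _)).
by rewrite eqxx.
Qed.

Lemma snoc_args k (s : seq V) Y : size s = k ->
  snoc (args s : 'I_k -> V) Y = args (rcons s Y).
Proof.
move=> sk; apply/funext => j; rewrite /snoc /args nth_rcons sk.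
case: unliftP => [l ->|->]; first by rewrite lift_max ltn_ord.
by rewrite /= ltnn eqxx.
Qed.

Lemma curry_last_scalar k (H : diff_form M k.+1) (X : 'I_k -> V) :
  scalar (fun Y => H (snoc X Y) : C).
Proof.
move=> a u v; rewrite (snoc_max X 0 u) (snoc_max X 0 v) (snoc_max X 0 (_ + _)).
exact: (altformP H).1.
Qed.

Lemma curry_last_subproof k (H : diff_form M k.+1) :
  (fun X : 'I_k -> V => mk_form1 (curry_last_scalar H X))
    \in @altform_pred C k V (diff_form M 1).
Proof.
apply/asboolP; split=> [i x a u v|x i j ij xij]; apply: altform_eqP => Y.
  change (H (snoc [eta x with i |-> a *: u + v] (Y ord0)) =
    a *: H (snoc [eta x with i |-> u] (Y ord0)) +
    H (snoc [eta x with i |-> v] (Y ord0))).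
  by rewrite !snoc_set (altformP H).1.
change (H (snoc x (Y ord0)) = 0).
apply: (altformP H).2 (_ : lift ord_max i != lift ord_max j) _.
  by rewrite (inj_eq lift_inj).
by rewrite /snoc !liftK.
Qed.

(* The bundle map Lambda^k TM -> T^*M with values H(X_1, ..., X_k, -) *)
Definition curry_last k (H : diff_form M k.+1) : altform k V (diff_form M 1) :=
  MkAltform (curry_last_subproof H).

End MkForms.

Section VfieldAlgebra.
Context {R : realType} {n : nat} {M : manifold R n}.
Local Notation C := (Cinf M).
Local Notation V := (vfield M).
Implicit Types (X Y Z : V) (f g : C) (alpha : diff_form M 1).

Lemma vD X f g : X (f + g) = X f + X g. Proof. by case: (vfieldP X). Qed.
Lemma vZ X a f : X (Ccst a * f) = Ccst a * X f. Proof. by case: (vfieldP X). Qed.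
Lemma vM X f g : X (f * g) = f * X g + g * X f. Proof. by case: (vfieldP X). Qed.
Lemma v0 X : X 0 = 0.
Proof. by have := vD X 0 0; rewrite addr0 => /esym/eqP; rewrite -subr_eq0 addrK => /eqP. Qed.
Lemma vN X f : X (- f) = - X f.
Proof. by apply/eqP; rewrite -addr_eq0 -vD addNr v0. Qed.
Lemma vB X f g : X (f - g) = X f - X g. Proof. by rewrite vD vN. Qed.

Lemma vfDE X Y f : (X + Y) f = X f + Y f. Proof. by []. Qed.
Lemma vfNE X f : (- X) f = - X f. Proof. by []. Qed.
Lemma vfZE a X f : (a *: X) f = a * X f. Proof. by []. Qed.
Lemma vf0E f : (0 : V) f = 0. Proof. by []. Qed.
Lemma bracketE X Y f : bracket X Y f = X (Y f) - Y (X f). Proof. by []. Qed.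

Lemma bracketDr X Y Z : bracket X (Y + Z) = bracket X Y + bracket X Z.
Proof. by apply: vfield_eqP => f; rewrite vfDE !bracketE !vfDE vD; ring. Qed.
Lemma bracketZr X a Y : bracket X (a *: Y) = a *: bracket X Y + X a *: Y.
Proof.
by apply: vfield_eqP => f; rewrite vfDE !bracketE !vfZE vM !bracketE; ring.
Qed.
Lemma bracketC X Y : bracket X Y = - bracket Y X.
Proof. by apply: vfield_eqP => f; rewrite vfNE !bracketE; ring. Qed.
Lemma jacobi X Y Z :
  bracket X (bracket Y Z) = bracket (bracket X Y) Z + bracket Y (bracket X Z).
Proof. by apply: vfield_eqP => f; rewrite vfDE !bracketE !vB; ring. Qed.

Local Notation "<< alpha , X >>" := (dual_pairing alpha X).

Lemma ext_d_term1 k (w : diff_form M k) e e' X X' y z :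
  e = e' -> X = X' -> (forall m, y m = z m) ->
  (-1) ^+ e * X (w y) = (-1) ^+ e' * X' (w z) :> C.
Proof. by move=> -> -> /funext ->. Qed.

Lemma ext_d_term2 k (w : diff_form M k) e e' y z :
  e = e' -> (forall m, y m = z m) ->
  (-1) ^+ e * w y = (-1) ^+ e' * w z :> C.
Proof. by move=> -> /funext ->. Qed.

Lemma ext_d1 (alpha : diff_form M 1) X Y :
  ext_d alpha (args [:: X; Y]) =
  X << alpha, Y >> - Y << alpha, X >> - << alpha, bracket X Y >>.
Proof.
rewrite /ext_d.
under [X in _ + X]eq_bigr => j _ do rewrite big_mkcond !big_ord_recl big_ord0.
rewrite !big_ord_recl !big_ord0 /=.
transitivity (((-1) ^+ 0 * X << alpha, Y >> + ((-1) ^+ 1 * Y << alpha, X >> + 0))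
  + ((0 + (0 + 0)) + (((-1) ^+ 1 * << alpha, bracket X Y >> + (0 + 0)) + 0)));
  last by ring.
rewrite /dual_pairing; congr (_ + _); do ?congr (_ + _) => //.
  by apply: ext_d_term1 => // -[[|//] ?].
by apply: ext_d_term2 => // -[[|//] ?].
Qed.

Lemma ext_d4 (w : diff_form M 4) (X0 X1 X2 X3 X4 : V) :
  let W X Y Z T := w (args [:: X; Y; Z; T]) : C in
  ext_d w (args [:: X0; X1; X2; X3; X4]) =
  X0 (W X1 X2 X3 X4) - X1 (W X0 X2 X3 X4) + X2 (W X0 X1 X3 X4)
  - X3 (W X0 X1 X2 X4) + X4 (W X0 X1 X2 X3)
  - W (bracket X0 X1) X2 X3 X4
  + (W (bracket X0 X2) X1 X3 X4 + W X0 (bracket X1 X2) X3 X4)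
  - (W (bracket X0 X3) X1 X2 X4 + W X0 (bracket X1 X3) X2 X4
     + W X0 X1 (bracket X2 X3) X4)
  + (W (bracket X0 X4) X1 X2 X3 + W X0 (bracket X1 X4) X2 X3
     + W X0 X1 (bracket X2 X4) X3 + W X0 X1 X2 (bracket X3 X4)).
Proof.
move=> W; rewrite /ext_d.
under [X in _ + X]eq_bigr => j _ do rewrite big_mkcond !big_ord_recl big_ord0.
rewrite !big_ord_recl !big_ord0 /=.
transitivity (
  ((-1) ^+ 0 * X0 (W X1 X2 X3 X4) + ((-1) ^+ 1 * X1 (W X0 X2 X3 X4) +
   ((-1) ^+ 2 * X2 (W X0 X1 X3 X4) + ((-1) ^+ 3 * X3 (W X0 X1 X2 X4) +
   ((-1) ^+ 4 * X4 (W X0 X1 X2 X3) + 0))))) +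
  ((0 + (0 + (0 + (0 + (0 + 0))))) +
  (((-1) ^+ 1 * W (bracket X0 X1) X2 X3 X4 + (0 + (0 + (0 + (0 + 0))))) +
  (((-1) ^+ 2 * W (bracket X0 X2) X1 X3 X4 +
   ((-1) ^+ 2 * W X0 (bracket X1 X2) X3 X4 + (0 + (0 + (0 + 0))))) +
  (((-1) ^+ 3 * W (bracket X0 X3) X1 X2 X4 +
   ((-1) ^+ 3 * W X0 (bracket X1 X3) X2 X4 +
   ((-1) ^+ 3 * W X0 X1 (bracket X2 X3) X4 + (0 + (0 + 0))))) +
  (((-1) ^+ 4 * W (bracket X0 X4) X1 X2 X3 +
   ((-1) ^+ 4 * W X0 (bracket X1 X4) X2 X3 +
   ((-1) ^+ 4 * W X0 X1 (bracket X2 X4) X3 +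
   ((-1) ^+ 4 * W X0 X1 X2 (bracket X3 X4) + (0 + 0))))) + 0))))));
  last by ring.
congr (_ + _); do ?congr (_ + _) => //.
all: try by apply: ext_d_term1 => // -[[|[|[|[|//]]]] ?].
all: by apply: ext_d_term2 => // -[[|[|[|[|//]]]] ?].
Qed.

Lemma pairE alpha (Y : 'I_1 -> V) : alpha Y = << alpha, Y ord0 >>.
Proof. by congr (altform_fun alpha _); apply/funext => i; rewrite ord1. Qed.

Lemma form1_eqP (alpha beta : diff_form M 1) :
  (forall X, << alpha, X >> = << beta, X >>) -> alpha = beta.
Proof. by move=> ab; apply: altform_eqP => Y; rewrite !pairE ab. Qed.

Lemma pair_scalar alpha : scalar (dual_pairing alpha).
Proof. by move=> a X Y; exact: (alt_linear alpha [::] ord0). Qed.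

Lemma pairDr alpha X Y : << alpha, X + Y >> = << alpha, X >> + << alpha, Y >>.
Proof. by rewrite -[X in LHS]scale1r pair_scalar mul1r. Qed.
Lemma pair0r alpha : << alpha, 0 >> = 0.
Proof. by apply: (@addIr _ << alpha, 0 >>); rewrite -pairDr !add0r. Qed.
Lemma pairZr alpha a X : << alpha, a *: X >> = a * << alpha, X >>.
Proof. by rewrite -[a *: X]addr0 pair_scalar pair0r addr0. Qed.
Lemma pairNr alpha X : << alpha, - X >> = - << alpha, X >>.
Proof. by apply/eqP; rewrite -addr_eq0 -pairDr addNr pair0r. Qed.

Lemma pairDl alpha beta X : << alpha + beta, X >> = << alpha, X >> + << beta, X >>.
Proof. by []. Qed.
Lemma pairNl alpha X : << - alpha, X >> = - << alpha, X >>. Proof. by []. Qed.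
Lemma pairZl a alpha X : << a *: alpha, X >> = a * << alpha, X >>. Proof. by []. Qed.
Lemma pair0l X : << 0, X >> = 0. Proof. by []. Qed.
Lemma pair_mk phi phiL X : << @mk_form1 R n M phi phiL, X >> = phi X.
Proof. by []. Qed.

Lemma lie_d_scalar X alpha : scalar (fun Y => X << alpha, Y >> - << alpha, bracket X Y >>).
Proof.
move=> a Y Z; rewrite pairDr pairZr vD vM bracketDr bracketZr !pairDr !pairZr; ring.
Qed.

Definition lie_d X alpha : diff_form M 1 := mk_form1 (lie_d_scalar X alpha).

Lemma contr_d_scalar X alpha : scalar (fun Y => ext_d alpha (args [:: X; Y])).
Proof.
move=> a Y Z; rewrite !ext_d1 pairDr pairZr vD vM bracketDr bracketZr.
by rewrite !pairDr !pairZr vfDE vfZE; ring.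
Qed.

Definition contr_d X alpha : diff_form M 1 := mk_form1 (contr_d_scalar X alpha).

Lemma lie_dE X alpha Y :
  << lie_d X alpha, Y >> = X << alpha, Y >> - << alpha, bracket X Y >>.
Proof. by []. Qed.

Lemma contr_dE X alpha Y :
  << contr_d X alpha, Y >> = X << alpha, Y >> - Y << alpha, X >> - << alpha, bracket X Y >>.
Proof. exact: ext_d1. Qed.

Lemma curry_lastE k (H : diff_form M k.+1) (s : seq V) Y : size s = k ->
  << curry_last H (args s), Y >> = H (args (rcons s Y)).
Proof. by move=> sk; rewrite -(@snoc_args _ _ _ k). Qed.

(* (T^*[1]M, TM, S, diamond, H) *)
Definition std_data (H : diff_form M 4) : clwx_data M := {|
  E1 := diff_form M 1;
  E0 := V;
  partial := fun=> 0;
  anchor := id;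
  pairing := fun e e' => << e.1, e'.2 >> + << e'.1, e.2 >>;
  dia_00 := @bracket R n M;
  dia_01 := lie_d;
  dia_10 := fun alpha X => - contr_d X alpha;
  Omega3 := curry_last H |}.

Lemma v_cst X a : X (Ccst a) = 0.
Proof.
have := vM X 1 1; rewrite !mul1r => /eqP; rewrite -subr_eq0 opprD addrA subrr add0r oppr_eq0 => /eqP X1.
by rewrite -[Ccst a]mulr1 vZ X1 mulr0.
Qed.

Lemma bracketDl X Y Z : bracket (X + Y) Z = bracket X Z + bracket Y Z.
Proof. by rewrite bracketC bracketDr opprD -!(bracketC _ Z). Qed.
Lemma bracketZl a X Y : bracket (a *: X) Y = a *: bracket X Y - Y a *: X.
Proof. by rewrite bracketC bracketZr opprD -scalerN -bracketC. Qed.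
Lemma bracket_jacobi X Y Z :
  bracket (bracket X Y) Z = bracket X (bracket Y Z) - bracket Y (bracket X Z).
Proof. by rewrite (jacobi X Y Z) addrK. Qed.

Definition form_simp := (vD, vN, v0, v_cst, vZ, vM, vfDE, vfNE, vfZE, vf0E,
  bracketDl, bracketDr, bracketZl, bracketZr,
  pairDr, pairNr, pairZr, pair0r, pairDl, pairNl, pairZl, pair0l, lie_dE, contr_dE).

Lemma std_leibniz_e1 X Y alpha :
  0 = lie_d X (lie_d Y alpha) - lie_d (bracket X Y) alpha - lie_d Y (lie_d X alpha).
Proof.
by apply: form1_eqP => Z; rewrite !form_simp bracket_jacobi !form_simp !bracketE; ring.
Qed.

Lemma std_leibniz_e2 X Y alpha :
  0 = lie_d X (- contr_d Y alpha) - - contr_d Y (lie_d X alpha)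
      - - contr_d (bracket X Y) alpha.
Proof.
apply: form1_eqP => Z.
by rewrite !form_simp bracket_jacobi !form_simp !bracketE; ring.
Qed.

Lemma std_leibniz_e3 X Y alpha :
  0 = - contr_d (bracket X Y) alpha - - contr_d Y (- contr_d X alpha)
      - lie_d X (- contr_d Y alpha).
Proof.
apply: form1_eqP => Z.
by rewrite !form_simp bracket_jacobi !form_simp !bracketE; ring.
Qed.

End VfieldAlgebra.

Section Standard.
Context {R : realType} {n : nat} {M : manifold R n}.
Local Notation C := (Cinf M).
Local Notation V := (vfield M).
Implicit Types (X Y Z : V) (alpha : diff_form M 1) (H : diff_form M 4).

Local Notation "<< alpha , X >>" := (dual_pairing alpha X).

Definition form4 H X Y Z T : C := H (args [:: X; Y; Z; T]).

Lemma form4_swap01 H X Y Z T : form4 H X Y Z T = - form4 H Y X Z T.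
Proof.
exact: (alt_swap H [:: 0; 0; Z; T] X Y (isT : @Ordinal 4 0 isT != @Ordinal 4 1 isT)).
Qed.
Lemma form4_swap12 H X Y Z T : form4 H X Y Z T = - form4 H X Z Y T.
Proof.
exact: (alt_swap H [:: X; 0; 0; T] Y Z (isT : @Ordinal 4 1 isT != @Ordinal 4 2 isT)).
Qed.
Lemma form4_swap23 H X Y Z T : form4 H X Y Z T = - form4 H X Y T Z.
Proof.
exact: (alt_swap H [:: X; Y; 0; 0] Z T (isT : @Ordinal 4 2 isT != @Ordinal 4 3 isT)).
Qed.

Definition Om H X Y Z : diff_form M 1 := curry_last H (args [:: X; Y; Z]).

Lemma OmE H X Y Z T : << Om H X Y Z, T >> = form4 H X Y Z T.
Proof. exact: curry_lastE. Qed.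

Lemma std_leibniz_f H : closed_form H -> forall W X Y Z,
  lie_d W (Om H X Y Z) - lie_d X (Om H W Y Z) + lie_d Y (Om H W X Z)
  + (- contr_d Z (Om H W X Y))
  - Om H (bracket W X) Y Z - Om H X (bracket W Y) Z - Om H X Y (bracket W Z)
  + Om H W (bracket X Y) Z + Om H W Y (bracket X Z) - Om H W X (bracket Y Z) = 0.
Proof.
move=> cH W X Y Z; apply: form1_eqP => T.
have := cH (args [:: W; X; Y; Z; T]); rewrite ext_d4 -!/(form4 _ _ _ _ _).
rewrite (form4_swap01 H (bracket W Y)).
rewrite (form4_swap01 H (bracket W Z)) (form4_swap12 H X (bracket W Z)).
rewrite (form4_swap12 H W (bracket X Z)).
rewrite (form4_swap01 H (bracket W T)) (form4_swap12 H X (bracket W T)).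
rewrite (form4_swap23 H X Y (bracket W T)).
rewrite (form4_swap12 H W (bracket X T)) (form4_swap23 H W Y (bracket X T)).
rewrite (form4_swap23 H W X (bracket Y T)).
by rewrite !(pairDl, pairNl, lie_dE, contr_dE, OmE, pair0l) => <-; ring.
Qed.

Lemma Ccst_half (f : C) : Ccst (2^-1) * (f + f) = f.
Proof.
rewrite -mulr2n -[f *+ 2]mulr_natl mulrA -(rmorph_nat (@Ccst R n M)) -rmorphM.
by rewrite mulVf ?rmorph1 ?mul1r // pnatr_eq0.
Qed.

Lemma Om_linear H : (forall X, bilin (Om H X)) /\ (forall Y Z, linear (Om H ^~ Y ^~ Z)).
Proof.
split=> [X|Y Z]; first split=> [Y|Z] a u v.
- exact: (alt_linear (curry_last H) [:: X; Y; 0] (@Ordinal 3 2 isT)).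
- exact: (alt_linear (curry_last H) [:: X; 0; Z] (@Ordinal 3 1 isT)).
- move=> a u v; exact: (alt_linear (curry_last H) [:: 0; Y; Z] (@Ordinal 3 0 isT)).
Qed.

Lemma Om0 H X Y Z : [\/ X = 0, Y = 0 | Z = 0] -> Om H X Y Z = 0.
Proof.
have [H1 H2] := Om_linear H.
have lin0 (f : V -> diff_form M 1) : linear f -> f 0 = 0.
  by move=> fL; have := fL (-1) 0 0; rewrite scaler0 addr0 scaleN1r addNr.
by case=> ->; [exact: lin0 (H2 Y Z)|exact: lin0 ((H1 X).2 Z)|exact: lin0 ((H1 X).1 Y)].
Qed.

Lemma lie_d0 X : lie_d X 0 = 0.
Proof. by apply: form1_eqP => Y; rewrite !form_simp; ring. Qed.
Lemma lie_0d alpha : lie_d 0 alpha = 0.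
Proof.
apply: form1_eqP => Y; rewrite -(scale0r (0 : V)) !form_simp; ring.
Qed.
Lemma contr_d0 X : contr_d X 0 = 0.
Proof. by apply: form1_eqP => Y; rewrite !form_simp; ring. Qed.

Lemma contr_0d alpha : contr_d 0 alpha = 0.
Proof. by apply: form1_eqP => Y; rewrite -(scale0r (0 : V)) !form_simp; ring. Qed.
Lemma bracket_0l X : bracket 0 X = 0.
Proof. by apply: vfield_eqP => f; rewrite bracketE !form_simp subrr. Qed.
Lemma bracket_0r X : bracket X 0 = 0.
Proof. by apply: vfield_eqP => f; rewrite bracketE !form_simp subrr. Qed.

Lemma std_is_leibniz2 H : closed_form H -> is_leibniz2 (leib2_of (std_data H)).
Proof.
move=> cH; split=> /=.
- by move=> a u v; rewrite scaler0 addr0.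
- split=> [X a Y Z|Z a X Y].
    change (bracket X (Ccst a *: Y + Z) = Ccst a *: bracket X Y + bracket X Z).
    by apply: vfield_eqP => f; rewrite !form_simp; ring.
  change (bracket (Ccst a *: X + Y) Z = Ccst a *: bracket X Z + bracket Y Z).
  by apply: vfield_eqP => f; rewrite !form_simp; ring.
- split=> [X a u v|u a X Y]; apply: form1_eqP => Z.
    by change (<< lie_d X (Ccst a *: u + v), Z >> = << Ccst a *: lie_d X u + lie_d X v, Z >>);
      rewrite !form_simp; ring.
  by change (<< lie_d (Ccst a *: X + Y) u, Z >> = << Ccst a *: lie_d X u + lie_d Y u, Z >>);
      rewrite !form_simp; ring.
- split=> [u a X Y|X a u v]; apply: form1_eqP => Z.
    by change (<< - contr_d (Ccst a *: X + Y) u, Z >> =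
      << Ccst a *: - contr_d X u + - contr_d Y u, Z >>); rewrite !form_simp; ring.
  by change (<< - contr_d X (Ccst a *: u + v), Z >> =
      << Ccst a *: - contr_d X u + - contr_d X v, Z >>); rewrite !form_simp; ring.
- have [H1 H2] := Om_linear H; split=> [X|Y Z a]; last exact: H2.
  by split=> [Y a|Z a]; [exact: (H1 X).1|exact: (H1 X).2].
- by move=> X u; apply/esym; exact: bracket_0r.
- by move=> u X; apply/esym; exact: bracket_0l.
- by move=> u v; change (lie_d 0 v = - contr_d 0 u); rewrite lie_0d contr_0d oppr0.
- move=> X Y Z.
  change (0 = bracket X (bracket Y Z) - bracket (bracket X Y) Z - bracket Y (bracket X Z)).
  by rewrite (jacobi X Y Z) addrAC addrK subrr.
- move=> X Y u; transitivity (0 : diff_form M 1); first by apply: Om0; constructor 3.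
  exact: std_leibniz_e1.
- move=> X u Y; transitivity (0 : diff_form M 1); first by apply: Om0; constructor 2.
  exact: std_leibniz_e2.
- move=> u X Y; transitivity (0 : diff_form M 1); first by apply: Om0; constructor 1.
  exact: std_leibniz_e3.
- exact: std_leibniz_f.
Qed.

Lemma std_is_clwx H : closed_form H -> is_clwx (std_data H).
Proof.
move=> cH; split=> /=.
- by move=> a u v; rewrite scaler0 addr0.
- by [].
- move=> [u X] a [v Y] [v' Y'].
  change (<< u, a *: Y + Y' >> + << a *: v + v', X >> =
    a * (<< u, Y >> + << v, X >>) + (<< u, Y' >> + << v', X >>)).
  by rewrite pairDr pairZr pairDl pairZl; ring.
- by move=> e e'; rewrite addrC.
- by move=> u v; rewrite !pair0r addr0.
- by move=> X Y; exact: addr0.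
- move=> [u X] uX; congr (_, _).
    by apply: form1_eqP => Y; have := uX (0, Y); rewrite /= [X in _ + X](_ : _ = 0) // addr0.
  apply: vfield_eqP => f; have df_scalar : scalar (fun Y : V => Y f) by [].
  by have := uX (mk_form1 df_scalar, 0); rewrite /= pair0r add0r.
- by move=> phi phiL; exists (mk_form1 phiL) => X; exact: addr0.
- exact: bracketC.
- exact: std_is_leibniz2.
- move=> [u X] v /= vX; congr (_, _); last first.
    by apply: vfield_eqP => f; rewrite bracketE subrr.
  apply: form1_eqP => Y.
  change (<< - contr_d X u + lie_d X u, Y >> = Ccst (2^-1) * << v, Y >>).
  have -> : << v, Y >> = Y (<< u, X >> + << u, X >>) by rewrite -vX; exact/esym/addr0.
  by rewrite vD Ccst_half !form_simp; ring.
- by move=> u v; change (0 + << v, 0 >> = << u, 0 >> + 0); rewrite !pair0r.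
- move=> [u1 X1] [u2 X2] [u3 X3].
  change (X1 (<< u2, X3 >> + << u3, X2 >>) =
    (<< - contr_d X2 u1 + lie_d X1 u2, X3 >> + << u3, bracket X1 X2 >>) +
    (<< u2, bracket X1 X3 >> + << - contr_d X3 u1 + lie_d X1 u3, X2 >>)).
  by rewrite !form_simp (bracketC X3 X2) !form_simp; ring.
- move=> X Y Z T.
  change (<< Om H X Y Z, T >> + 0 = - (0 + << Om H X Y T, Z >>)).
  by rewrite addr0 add0r !OmE; exact: form4_swap23.
Qed.

Definition std_clwx H (cH : closed_form H) : clwx M := Clwx (std_is_clwx cH).

Lemma std_skeletal H : skeletal (std_data H).
Proof. by []. Qed.

Lemma std_exact H : exact_clwx (std_data H).
Proof.
split=> /=.
- move=> alpha alpha0; apply: form1_eqP => X; rewrite -(alpha0 X).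
  exact: addr0.
- by move=> u; split=> // _; exists u => X; exact: addr0.
- by move=> X; split=> [->|[_ ->]]; [exists 0|].
- by move=> X; exists X.
Qed.

End Standard.

(* Main.v *)
Require Import Defs.
From mathcomp Require Import all_boot all_order all_algebra.
From mathcomp Require Import all_classical all_reals all_analysis.
From mathcomp Require Import ring.
Set Implicit Arguments.
Unset Strict Implicit.
Unset Printing Implicit Defensive.
Import Order.TTheory GRing.Theory Num.Theory.
Local Open Scope ring_scope.

(** Why the theorem holds.

    The anchor of each of the two algebroids is the identity of TM, and the
    pairing is the evaluation of 1-forms on vector fields.  An isomorphism
    commutes with both, so its linear parts are identities and all that is left
    of it is the bundle map phi : Lambda^2 TM -> T^*M.  As the differential of
    the two Leibniz 2-algebras vanishes, the only condition on phi is the last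
    axiom of a morphism, which reads
      leib_coboundary phi = Omega_H - Omega_H'
    where leib_coboundary is the differential of Leibniz cochains with values in
    T^*M (clwx_iso_idP).

    If phi is the contraction of a 3-form K, the left hand side is the
    contraction of the exterior derivative of K, so a primitive of H - H' yields
    an isomorphism.

    Conversely one has to see that k(X, Y, Z) = << phi(X, Y), Z >> is totally
    skew-symmetric, although phi is only required to be so in X and Y.
    Tensoriality forces it.  The right hand side is linear over functions,
    whereas, when X is multiplied by f, the left hand side produces the extra
    term T(f) (k(Y, Z, X) - k(X, Y, Z)) (leib_coboundary_scale).  Hence
    g = k(Y, Z, X) - k(X, Y, Z) satisfies g T(f) = 0 for all T and f, that is,
    g T = 0 for every vector field T.  Since k is linear over functions,
    multiplying g by itself gives g^2 = k(Y, Z, g X) - k(g X, Y, Z) = 0, and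
    g = 0 because the smooth functions form a reduced ring (tri_cyclic).  So k
    is invariant under cyclic permutations, and with the skew-symmetry of phi
    it is a 3-form whose exterior derivative is H - H'. *)

Section Isomorphisms.
Context {R : realType} {n : nat} {M : manifold R n}.
Local Notation C := (Cinf M).
Local Notation V := (vfield M).
Implicit Types (X Y Z T : V) (f g : C) (K : diff_form M 3).
Implicit Types (phi : altform 2 V (diff_form M 1)) (H : diff_form M 4).

Local Notation "<< alpha , X >>" := (dual_pairing alpha X).

(** * Exterior derivative of a 3-form *)

Lemma ext_d3 K X0 X1 X2 X3 :
  let k X Y Z := K (args [:: X; Y; Z]) : C in
  ext_d K (args [:: X0; X1; X2; X3]) =
  X0 (k X1 X2 X3) - X1 (k X0 X2 X3) + X2 (k X0 X1 X3) - X3 (k X0 X1 X2)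
  - k (bracket X0 X1) X2 X3
  + (k (bracket X0 X2) X1 X3 + k X0 (bracket X1 X2) X3)
  - (k (bracket X0 X3) X1 X2 + k X0 (bracket X1 X3) X2
     + k X0 X1 (bracket X2 X3)).
Proof.
move=> k; rewrite /ext_d.
under [X in _ + X]eq_bigr => j _ do rewrite big_mkcond !big_ord_recl big_ord0.
rewrite !big_ord_recl !big_ord0 /=.
(* The unfolded sums: the zeros are the ends of the sums and, in the second
   part, the pairs of indices i, j with i >= j. *)
transitivity (
  ((-1) ^+ 0 * X0 (k X1 X2 X3) + ((-1) ^+ 1 * X1 (k X0 X2 X3) +
   ((-1) ^+ 2 * X2 (k X0 X1 X3) + ((-1) ^+ 3 * X3 (k X0 X1 X2) + 0)))) +
  ((0 + (0 + (0 + (0 + 0)))) +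
  (((-1) ^+ 1 * k (bracket X0 X1) X2 X3 + (0 + (0 + (0 + 0)))) +
  (((-1) ^+ 2 * k (bracket X0 X2) X1 X3 +
   ((-1) ^+ 2 * k X0 (bracket X1 X2) X3 + (0 + (0 + 0)))) +
  (((-1) ^+ 3 * k (bracket X0 X3) X1 X2 +
   ((-1) ^+ 3 * k X0 (bracket X1 X3) X2 +
   ((-1) ^+ 3 * k X0 X1 (bracket X2 X3) + (0 + 0)))) + 0)))));
  last by ring.
congr (_ + _); do ?congr (_ + _) => //.
all: try by apply: ext_d_term1 => // -[[|[|[|//]]] ?].
all: by apply: ext_d_term2 => // -[[|[|[|//]]] ?].
Qed.

(** * The trilinear map of a bundle map from bivectors to 1-forms *)

Definition tri phi X Y Z : C := << phi (args [:: X; Y]), Z >>.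

Lemma alt_args0 k (W : lmodType C) (w : altform k V W) (s : seq V) (i : 'I_k) :
  s`_i = 0 -> w (args s) = 0.
Proof.
move=> si0; have := alt_linear w s i (-1) 0 0.
rewrite scaler0 addr0 scaleN1r addNr args_set => <-; congr (altform_fun w _).
by apply/funext => j /=; case: eqP => [->|].
Qed.

Lemma triDl phi X X' Y Z : tri phi (X + X') Y Z = tri phi X Y Z + tri phi X' Y Z.
Proof.
have := alt_linear phi [:: 0; Y] (@Ordinal 2 0 isT) 1 X X'; rewrite /= !scale1r.
by rewrite /tri => ->.
Qed.

Lemma triZl phi a X Y Z : tri phi (a *: X) Y Z = a * tri phi X Y Z.
Proof.
have := alt_linear phi [:: 0; Y] (@Ordinal 2 0 isT) a X 0; rewrite /= addr0 /tri => ->.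
by rewrite (@alt_args0 2 _ phi [:: 0; Y] (@Ordinal 2 0 isT)) // addr0.
Qed.

Lemma triC phi X Y Z : tri phi X Y Z = - tri phi Y X Z.
Proof.
have := alt_swap phi [:: 0; 0] X Y (isT : @Ordinal 2 0 isT != @Ordinal 2 1 isT).
by rewrite /tri /= => ->.
Qed.

Lemma triXX phi X Y : tri phi X X Y = 0.
Proof.
by rewrite /tri (alt_eq0 phi (isT : @Ordinal 2 0 isT != @Ordinal 2 1 isT)).
Qed.

Lemma triZr phi a X Y Z : tri phi X Y (a *: Z) = a * tri phi X Y Z.
Proof. exact: pairZr. Qed.

Lemma triDr phi X Y Z Z' : tri phi X Y (Z + Z') = tri phi X Y Z + tri phi X Y Z'.
Proof. exact: pairDr. Qed.

Lemma triNr phi X Y Z : tri phi X Y (- Z) = - tri phi X Y Z.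
Proof. exact: pairNr. Qed.

Lemma triNl phi X Y Z : tri phi (- X) Y Z = - tri phi X Y Z.
Proof. by rewrite -scaleN1r triZl mulN1r. Qed.

(** * The coboundary of such a bundle map *)

(** The differential of phi as a 2-cochain of the Leibniz algebra of vector
    fields with values in T^*M, on which a field X acts from the left by the Lie
    derivative and from the right by - contr_d X; this explains the sign of
    the third term. *)
Definition leib_coboundary phi X Y Z : diff_form M 1 :=
  let p X Y := phi (args [:: X; Y]) in
  lie_d X (p Y Z) - lie_d Y (p X Z) + contr_d Z (p X Y)
  - p (bracket X Y) Z + p X (bracket Y Z) - p Y (bracket X Z).

Lemma pair_leib_coboundary phi X Y Z T : << leib_coboundary phi X Y Z, T >> =
  (X (tri phi Y Z T) - tri phi Y Z (bracket X T))
  - (Y (tri phi X Z T) - tri phi X Z (bracket Y T))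
  + (Z (tri phi X Y T) - T (tri phi X Y Z) - tri phi X Y (bracket Z T))
  - tri phi (bracket X Y) Z T + tri phi X (bracket Y Z) T
  - tri phi Y (bracket X Z) T.
Proof. by rewrite !(pairDl, pairNl) !lie_dE contr_dE. Qed.

(** Lie derivatives and brackets are not linear over functions in X.  All the
    derivatives of f cancel, by the skew-symmetry of phi, except those along the
    last argument T. *)
Lemma leib_coboundary_scale phi f X Y Z T :
  << leib_coboundary phi (f *: X) Y Z, T >> = f * << leib_coboundary phi X Y Z, T >>
    + T f * (tri phi Y Z X - tri phi X Y Z).
Proof.
rewrite !pair_leib_coboundary (triC phi Y (bracket (f *: X) Z)) (triC phi Y (bracket X Z)).
rewrite !bracketZl !(triDl, triDr, triNl, triNr, triZl, triZr, vM, vfZE).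
by rewrite (triC phi X Y); ring.
Qed.

Lemma Cinf_sqr_eq0 g : g * g = 0 -> g = 0.
Proof.
move=> gg; apply: CinfP => p.
have gp : g p * g p = 0 by exact: (congr1 (fun h : C => h p) gg).
by move/eqP: gp; rewrite mulf_eq0 orbb => /eqP.
Qed.

(** The functions g on which k = tri phi could fail to be cyclic annihilate all
    vector fields by leib_coboundary_scale.  As g is a difference of values
    of k, which is linear over functions, g kills itself as well, so g^2 = 0. *)
Lemma tri_cyclic phi :
  (forall f X Y Z, leib_coboundary phi (f *: X) Y Z = f *: leib_coboundary phi X Y Z) ->
  forall X Y Z, tri phi X Y Z = tri phi Y Z X.
Proof.
move=> dZ X Y Z; apply/esym/eqP; rewrite -subr_eq0; apply/eqP.
set g := _ - _.
have g0 T : g *: T = 0.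
  apply: vfield_eqP => f; rewrite vfZE vf0E mulrC.
  have := leib_coboundary_scale phi f X Y Z T.
  by rewrite dZ pairZl -[LHS]addr0 => /addrI.
apply: Cinf_sqr_eq0; rewrite {2}/g mulrBr.
by rewrite -triZr -triZl !g0 -(scale0r (0 : V)) triZl triZr !mul0r subrr.
Qed.

(** * The 3-form of a cyclic bundle map *)

Section CyclicForm.
Variable phi : altform 2 V (diff_form M 1).
Hypothesis cyc : forall X Y Z, tri phi X Y Z = tri phi Y Z X.

Definition tri_fun (x : 'I_3 -> V) : C^o :=
  tri phi (x (@Ordinal 3 0 isT)) (x (@Ordinal 3 1 isT)) (x (@Ordinal 3 2 isT)).

(** The values on repeated arguments reduce to tri phi X X Y by a cyclic
    permutation. *)
Lemma tri_fun_subproof : tri_fun \in @altform_pred C 3 V C^o.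
Proof.
have lin a X X' Y Z : tri phi (a *: X + X') Y Z = a * tri phi X Y Z + tri phi X' Y Z.
  by rewrite triDl triZl.
apply/asboolP; split=> [i x a u v|x i j].
  rewrite /tri_fun; case: i => [[|[|[|//]]] ?] /=.
  - exact: lin.
  - by rewrite 3!(cyc (x _)) lin.
  - by rewrite triDr triZr.
rewrite /tri_fun => ij.
have XYX X Y : tri phi X Y X = 0 by rewrite -cyc triXX.
have YXX X Y : tri phi Y X X = 0 by rewrite cyc triXX.
case: i j ij => [[|[|[|//]]] hi] [[|[|[|//]]] hj] // _.
all: rewrite ?(bool_irrelevance hi isT) ?(bool_irrelevance hj isT) => ->.
all: by rewrite ?triXX ?XYX ?YXX.
Qed.

Definition tri_form : diff_form M 3 := MkAltform tri_fun_subproof.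

Lemma tri_formE X Y Z : tri_form (args [:: X; Y; Z]) = tri phi X Y Z.
Proof. by []. Qed.

(** For a totally skew-symmetric tri phi the Leibniz coboundary is the
    Chevalley-Eilenberg one, which is Koszul's formula. *)
Lemma pair_leib_coboundary_cyclic X Y Z T :
  << leib_coboundary phi X Y Z, T >> = ext_d tri_form (args [:: X; Y; Z; T]).
Proof.
rewrite pair_leib_coboundary ext_d3 !tri_formE.
(* In the coboundary the brackets with T are in the last argument of tri phi;
   in Koszul's formula they replace X, Y or Z. *)
rewrite (cyc (bracket X T)) (triC phi X (bracket Y T)) (cyc (bracket Y T)).
rewrite (triC phi (bracket X Z)).
ring.
Qed.

End CyclicForm.

(** * Isomorphisms between standard algebroids *)

(** The anchor determines Phi0, and then the nondegenerate pairing determines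
    Phi1. *)
Lemma clwx_iso_id H H' (cH : closed_form H) (cH' : closed_form H') Phi0 Phi1 phi :
  is_clwx_isomorphism (D := std_clwx cH) (D' := std_clwx cH') Phi0 Phi1 phi ->
  Phi0 = id /\ Phi1 = id.
Proof.
case=> _ _ _ _ Phi0E Phi1E _.
have {}Phi0E : Phi0 = id by apply/funext => X; exact: Phi0E.
split=> //; apply/funext => alpha; apply: form1_eqP => X.
have := Phi1E X alpha; rewrite Phi0E.
change (0 + << Phi1 alpha, X >> = 0 + << alpha, X >> -> << Phi1 alpha, X >> = << alpha, X >>).
by rewrite !add0r.
Qed.

(** Since the differentials vanish, all the axioms but the last one hold for
    any phi, and the last one is the stated equation up to rearrangement. *)
Lemma clwx_iso_idP H H' (cH : closed_form H) (cH' : closed_form H') phi :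
  is_clwx_isomorphism (D := std_clwx cH) (D' := std_clwx cH') id id phi <->
  forall X Y Z, leib_coboundary phi X Y Z = Om H X Y Z - Om H' X Y Z.
Proof.
have rearr X Y Z : - Om H X Y Z + lie_d X (phi (args [:: Y; Z]))
    - lie_d Y (phi (args [:: X; Z])) - - contr_d Z (phi (args [:: X; Y]))
    - phi (args [:: bracket X Y; Z]) + phi (args [:: X; bracket Y Z])
    - phi (args [:: Y; bracket X Z]) + Om H' X Y Z =
    leib_coboundary phi X Y Z - (Om H X Y Z - Om H' X Y Z).
  by apply: form1_eqP => T; rewrite /leib_coboundary !(pairDl, pairNl); ring.
split=> [[_ _ _ _ _ _ [[_ _ _ _ _ _ _ E] _ _]] X Y Z|E].
  have := E X Y Z; rewrite [LHS](rearr X Y Z) => /eqP.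
  by rewrite subr_eq0 => /eqP.
split=> //; try by exists id.
split; try by exists id.
split=> //=.
- split=> [X a Y Z|Z a X Y].
    exact: (alt_linear phi [:: X; 0] (@Ordinal 2 1 isT)).
  exact: (alt_linear phi [:: 0; Z] (@Ordinal 2 0 isT)).
- by move=> X Y; exact: subrr.
- move=> X alpha; rewrite [LHS]subrr.
  by rewrite (@alt_args0 2 _ phi [:: X; 0] (@Ordinal 2 1 isT)).
- move=> alpha X; rewrite [LHS]subrr.
  by rewrite (@alt_args0 2 _ phi [:: 0; X] (@Ordinal 2 0 isT)).
- by move=> X Y Z; rewrite [LHS](rearr X Y Z) E subrr.
Qed.

End Isomorphisms.

(** * Classification *)

Lemma args4E (V : zmodType) (x : 'I_4 -> V) :
  x = args [:: x (@Ordinal 4 0 isT); x (@Ordinal 4 1 isT);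
               x (@Ordinal 4 2 isT); x (@Ordinal 4 3 isT)].
Proof.
by apply/funext => -[[|[|[|[|//]]]] hi]; congr x; exact: val_inj.
Qed.

Lemma curry_last_cyclic (R : realType) n (M : manifold R n) (K : diff_form M 3)
    (X Y Z : vfield M) :
  tri (curry_last K) X Y Z = tri (curry_last K) Y Z X.
Proof.
rewrite /tri !curry_lastE //=.
rewrite (alt_swap K [:: 0; 0; Z] X Y (isT : @Ordinal 3 0 isT != @Ordinal 3 1 isT)) /=.
rewrite (alt_swap K [:: Y; 0; 0] X Z (isT : @Ordinal 3 1 isT != @Ordinal 3 2 isT)) /=.
exact: opprK.
Qed.

Theorem theorem5p4 (R : realType) (n : nat) (M : manifold R n) (H H' : diff_form M 4)
    (closedH : closed_form H) (closedH' : closed_form H') :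
  clwx_isomorphic (std_clwx closedH) (std_clwx closedH') <-> cohomologous H H'.
Proof.
split=> [[Phi0 [Phi1 [phi iso]]]|[K HK]].
  have [E0 E1] := clwx_iso_id iso; rewrite {}E0 {}E1 in iso.
  move/clwx_iso_idP: iso => dE.
  have cyc : forall X Y Z, tri phi X Y Z = tri phi Y Z X.
    apply: tri_cyclic => f X Y Z; rewrite !dE.
    have OmZ H0 : Om H0 (f *: X) Y Z = f *: Om H0 X Y Z.
      have [_ linX] := Om_linear H0.
      have := linX Y Z f X 0; rewrite addr0 => ->.
      by rewrite (_ : Om H0 0 Y Z = 0) ?addr0 //; apply: Om0; constructor 1.
    by rewrite !OmZ scalerBr.
  exists (tri_form cyc) => x; rewrite (args4E x) -pair_leib_coboundary_cyclic dE.
  by rewrite pairDl pairNl !OmE.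
exists id, id, (curry_last K); apply/clwx_iso_idP => X Y Z.
apply: form1_eqP => T; rewrite (pair_leib_coboundary_cyclic (@curry_last_cyclic _ _ _ K)).
rewrite (_ : tri_form _ = K); last first.
  apply: altform_eqP => x; rewrite /= /tri_fun /tri curry_lastE //=.
  congr (altform_fun K); apply/funext => -[[|[|[|//]]] hi]; congr x; exact: val_inj.
by rewrite -HK pairDl pairNl !OmE.
Qed.
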